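(* Let $\Phi=\{\phi_i\}_{i=1}^n\subset L^2(X,\rho)$. Let $(\Omega,\mathcal F,\mathbb P)$ be a probability space and let $\delta_1,\dots,\delta_n\in L^2(\Omega;L^\infty(X))$ be random functions such that 1. (zero mean) for every $x\in X$ and every $i$: $\mathbb E[\delta_i(x)]=0$; 2. (uncorrelatedness) for every $x\in X$ and all $i\neq j$: $\mathbb E[\overline{\delta_i(x)}\,\delta_j(x)]=0$. Define $\widetilde\Phi=\{\widetilde\phi_i\}_{i=1}^n$ by $\widetilde\phi_i=\phi_i(1+\delta_i)$. Let $u>0$ and assume that there exists a constant $C>0$ such that $$\mathbb E\left[\|\widetilde\phi_i-\phi_i\|_{L^2_\rho}^2\right]\ge C u^2,\qquad 1\le i\le n.$$ Then, for every $c\in\mathbb C^n$ and every $f\in L^2(X,\rho)$, $$\mathbb E\left[\|\widetilde{\mathcal T}c-f\|_{L^2_\rho}^2\right]\ \ge\ \|\mathcal Tc-f\|_{L^2_\rho}^2+C u^2\|c\|_2^2,$$ where $\mathcal Tc=\sum_{i=1}^n c_i\phi_i$ and $\widetilde{\mathcal T}c=\sum_{i=1}^n c_i\widetilde\phi_i$.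
   Context: $X\subseteq\mathbb R^d$ is measurable and $\rho$ is a non-atomic probability measure on $X$. $L^2(X,\rho)$ is the complex Hilbert space with inner product $\langle f,g\rangle_{L^2_\rho}=\int_X\overline f\,g\,d\rho$ and norm $\|\cdot\|_{L^2_\rho}$. $\|\cdot\|_2$ is the Euclidean norm on $\mathbb C^n$. The condition $\delta_i\in L^2(\Omega;L^\infty(X))$ means that $\delta_i:\Omega\to L^\infty(X)$ is Bochner square-integrable, i.e. $\mathbb E[\|\delta_i\|_{L^\infty}^2]<\infty$; the dependence on $\omega\in\Omega$ is suppressed and $\delta_i(x)$ denotes $\delta_i(\omega)(x)$. The functions $\phi_i$, the vector $c$ and the function $f$ are deterministic. The number $u$ plays the role of the unit roundoff.
   Formalization: Since point values of elements of L^∞(X) are undefined, the random functions δ_i are taken as representatives that are jointly measurable in (ω,x); for arbitrary representatives the claim can fail (under the continuum hypothesis). *)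

(* Defs.v *)
From HB Require Import structures.
From mathcomp Require Import all_boot all_order all_algebra.
From mathcomp Require Import all_classical all_reals all_analysis.
From mathcomp Require Export complex.

Set Implicit Arguments.
Unset Strict Implicit.
Unset Printing Implicit Defensive.

Import Order.TTheory GRing.Theory Num.Theory.
Import numFieldNormedType.Exports.

Local Open Scope classical_set_scope.
Local Open Scope complex_scope.
Local Open Scope ring_scope.

(* R[i] carries no sigma-algebra in the library; real and imaginary parts are
   Borel exactly when the function is Borel for C = R^2. *)
Definition cmeasurable_fun (dT : measure_display) (T : measurableType dT)
    (R : realType) (D : set T) (f : T -> R[i]) : Prop :=
  measurable_fun D (fun x => complex.Re (f x)) /\
  measurable_fun D (fun x => complex.Im (f x)).

(* Functions on X and measures on X are represented on the ambient space:
   functions are only ever looked at on X, and measures on X are extended by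
   zero, so that a probability measure rho on X is one with rho X = 1. *)
Section function_spaces.
Context (dT : measure_display) (T : measurableType dT) (R : realType).
Variables (X : set T) (rho : probability T R).

Definition nonatomic : Prop :=
  forall A : set T, measurable A -> (0 < rho A)%E ->
  exists B : set T, [/\ measurable B, B `<=` A, (0 < rho B)%E
                      & (rho B < rho A)%E].

Definition L2norm (f : T -> R[i]) : \bar R :=
  ('N[rho]_2%:E[(fun x => (Normc.normc (f x))%:E) \_ X])%E.

Definition Linftynorm (f : T -> R[i]) : \bar R :=
  ('N[rho]_+oo[(fun x => (Normc.normc (f x))%:E) \_ X])%E.

Definition in_L2 (f : T -> R[i]) : Prop :=
  cmeasurable_fun X f /\ (L2norm f < +oo)%E.

Definition in_Linfty (f : T -> R[i]) : Prop :=
  cmeasurable_fun X f /\ (Linftynorm f < +oo)%E.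

End function_spaces.

Section random.
Context (dO : measure_display) (Omega : measurableType dO) (R : realType).
Variable P : probability Omega R.

Definition cintegrable (Z : Omega -> R[i]) : Prop :=
  P.-integrable setT (fun w => (complex.Re (Z w))%:E) /\
  P.-integrable setT (fun w => (complex.Im (Z w))%:E).

Definition cexpectation (Z : Omega -> R[i]) : R[i] :=
  fine ('E_P[fun w => complex.Re (Z w)])%E +i*
  fine ('E_P[fun w => complex.Im (Z w)])%E.

(* [fine] sends infinite values to 0, hence the explicit integrability. *)
Definition has_cexpectation (Z : Omega -> R[i]) (m : R[i]) : Prop :=
  cintegrable Z /\ cexpectation Z = m.

Context (dT : measure_display) (T : measurableType dT).
Variables (X : set T) (rho : probability T R).

Definition Linfty_simple (s : Omega -> T -> R[i]) : Prop :=
  exists (m : nat) (A : 'I_m -> set Omega) (g : 'I_m -> T -> R[i]),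
    [/\ forall j, measurable (A j),
        forall j, in_Linfty X rho (g j)
      & forall w x, s w x = \sum_(j < m) (\1_(A j) w)%:C * g j x].

Definition bochner_measurable (delta : Omega -> T -> R[i]) : Prop :=
  exists s : nat -> Omega -> T -> R[i],
    (forall k, Linfty_simple (s k)) /\
    {ae P, forall w,
       (fun k => Linftynorm X rho (fun x => s k w x - delta w x))
         @ \oo --> 0%E}.

(* Membership of delta in L^2(Omega; L^infty(X)), where delta w is a
   representative of the L^infty class. *)
Definition in_L2_Linfty (delta : Omega -> T -> R[i]) : Prop :=
  [/\ forall w, in_Linfty X rho (delta w),
      bochner_measurable delta
    & (\int[P]_w (Linftynorm X rho (delta w)) ^+ 2 < +oo)%E].

(* Evaluation at a point is not defined on L^infty classes, so statistics of
   delta(x) refer to a choice of representatives. The representatives are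
   taken jointly measurable in (w, x); every Bochner measurable delta has such
   a version, and without this the values w |-> delta w x would be unrelated
   to the L^infty-valued map delta. *)
Definition random_function (delta : Omega -> T -> R[i]) : Prop :=
  cmeasurable_fun ([set: Omega] `*` X) (fun p : Omega * T => delta p.1 p.2).

End random.

Section frames.
Context (T : Type) (R : rcfType) (n : nat).

Definition cnorm2 (c : 'cV[R[i]]_n) : R :=
  Num.sqrt (\sum_(i < n) Normc.normc (c i 0) ^+ 2).

Definition synthesis (phi : 'I_n -> T -> R[i]) (c : 'cV[R[i]]_n) : T -> R[i] :=
  fun x => \sum_(i < n) c i 0 * phi i x.

Definition perturb (Omega : Type) (phi : 'I_n -> T -> R[i])
    (delta : 'I_n -> Omega -> T -> R[i]) (w : Omega) : 'I_n -> T -> R[i] :=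
  fun i x => phi i x * (1 + delta i w x).

End frames.

(* Main.v *)
Require Import Defs.
From HB Require Import structures.
From mathcomp Require Import all_boot all_order all_algebra.
From mathcomp Require Import all_classical all_reals all_analysis.
From mathcomp Require Import measurable_realfun ring.

(** Fix [x] in [X] and put [h = synthesis phi c - f]. The perturbed residual at
    [x] is [h x + \sum_i Z i] with [Z i = c i * phi i x * delta i w x]. The
    [Z i] have mean zero and are pairwise uncorrelated, because these properties
    are inherited from [delta] under multiplication by deterministic constants.
    Expanding the squared modulus, all cross terms vanish in expectation and
    [E |h x + \sum_i Z i|^2 = |h x|^2 + \sum_i E |Z i|^2]
    ([second_moment_uncorrelated]).

    Integrating this identity over [X] and exchanging the order of integration
    by Tonelli's theorem ([tonelli_subset]) gives the exact bias-variance
    decomposition [expected_synthesis_error]: the expected squared error equals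
    the squared error of [synthesis phi c] plus the sum over [i] of [|c i|^2]
    times the expected squared size of the perturbation of [phi i]. Bounding
    each of these expectations below by [C * u ^+ 2] yields the theorem.

    Everything is computed with integrals of nonnegative functions in
    [[0, +oo]]. The only signed quantity is the cross term at a fixed [x], which
    is integrable over the probability space by the definition of
    [has_cexpectation]; [ge0_integral_add_centred] adds it to a function that
    need not be integrable. *)

Set Implicit Arguments.
Unset Strict Implicit.
Unset Printing Implicit Defensive.

Import Order.TTheory GRing.Theory Num.Theory.
Import numFieldNormedType.Exports.

Local Open Scope classical_set_scope.
Local Open Scope complex_scope.
Local Open Scope ring_scope.

(** * Squared moduli of complex sums *)

Lemma normc_sqr (R : rcfType) (z : R[i]) :
  Normc.normc z ^+ 2 = complex.Re z ^+ 2 + complex.Im z ^+ 2.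
Proof. by case: z => a b /=; rewrite sqr_sqrtr// addr_ge0// sqr_ge0. Qed.

Lemma normc_nneg (R : rcfType) (z : R[i]) : 0 <= Normc.normc z.
Proof. by case: z => a b; exact: sqrtr_ge0. Qed.

Lemma normc_sqr_ge0 (R : rcfType) (z : R[i]) : 0 <= Normc.normc z ^+ 2.
Proof. exact: sqr_ge0. Qed.

Lemma normc_sqr_conj (R : rcfType) (z : R[i]) :
  Normc.normc z ^+ 2 = complex.Re (z^* * z).
Proof. by rewrite normc_sqr; case: z => a b /=; ring. Qed.

Lemma normc_sqrD (R : rcfType) (a b : R[i]) :
  Normc.normc (a + b) ^+ 2 =
  Normc.normc a ^+ 2 + Normc.normc b ^+ 2 + complex.Re (2 * a^* * b).
Proof.
rewrite !normc_sqr -mulrA mulr_natl mulr2n; case: a => a1 a2; case: b => b1 b2.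
by rewrite /=; ring.
Qed.

Lemma Re_sum (R : rcfType) (n : nat) (z : 'I_n -> R[i]) :
  complex.Re (\sum_i z i) = \sum_i complex.Re (z i).
Proof. by apply: (big_morph (@complex.Re R)) => // -[a b] [c e]. Qed.

(** The off-diagonal terms are kept inside a single real part because only
    their total has to average out to zero. *)
Lemma normc_sqr_sum (R : rcfType) (n : nat) (z : 'I_n -> R[i]) :
  Normc.normc (\sum_i z i) ^+ 2 =
  \sum_i Normc.normc (z i) ^+ 2 +
  complex.Re (\sum_i \sum_(j | j != i) (z i)^* * z j).
Proof.
rewrite normc_sqr_conj rmorph_sum mulr_suml.
have -> : \sum_i (z i)^* * (\sum_j z j) =
    \sum_i (z i)^* * z i + \sum_i \sum_(j | j != i) (z i)^* * z j.
  rewrite -big_split; apply: eq_bigr => i _ /=.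
  by rewrite mulr_sumr (bigD1 i).
rewrite [LHS](_ : _ = complex.Re (\sum_i (z i)^* * z i) +
  complex.Re (\sum_i \sum_(j | j != i) (z i)^* * z j)); last first.
  by case: (\sum_i (z i)^* * z i) => a b; case: (\sum_i _) => a' b'.
by rewrite Re_sum; congr (_ + _); apply: eq_bigr => i _; rewrite normc_sqr_conj.
Qed.

(** * Measurability of complex functions *)

Section cmeasurable.
Context (dT : measure_display) (T : measurableType dT) (R : realType).
Variable D : set T.
Implicit Types f g : T -> R[i].

Lemma cmeasurable_cst (a : R[i]) : cmeasurable_fun D (fun=> a).
Proof. by split; exact: measurable_cst. Qed.

Lemma cmeasurableD f g : cmeasurable_fun D f -> cmeasurable_fun D g ->
  cmeasurable_fun D (fun x => f x + g x).
Proof.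
move=> [f1 f2] [g1 g2]; split.
- rewrite (_ : (fun _ => _) =
    (fun x => complex.Re (f x) + complex.Re (g x))).
    exact: measurable_funD.
  by apply/funext => x; case: (f x) => ? ?; case: (g x).
- rewrite (_ : (fun _ => _) =
    (fun x => complex.Im (f x) + complex.Im (g x))).
    exact: measurable_funD.
  by apply/funext => x; case: (f x) => ? ?; case: (g x).
Qed.

Lemma cmeasurableM f g : cmeasurable_fun D f -> cmeasurable_fun D g ->
  cmeasurable_fun D (fun x => f x * g x).
Proof.
move=> [f1 f2] [g1 g2]; split.
- rewrite (_ : (fun _ => _) = (fun x =>
    complex.Re (f x) * complex.Re (g x) - complex.Im (f x) * complex.Im (g x))).
    by apply: measurable_funB; exact: measurable_funM.
  by apply/funext => x; case: (f x) => ? ?; case: (g x).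
- rewrite (_ : (fun _ => _) = (fun x =>
    complex.Re (f x) * complex.Im (g x) + complex.Im (f x) * complex.Re (g x))).
    by apply: measurable_funD; exact: measurable_funM.
  by apply/funext => x; case: (f x) => ? ?; case: (g x).
Qed.

Lemma cmeasurable_sum (n : nat) (f : 'I_n -> T -> R[i]) :
  (forall i, cmeasurable_fun D (f i)) ->
  cmeasurable_fun D (fun x => \sum_i f i x).
Proof.
move=> mf; elim: n f mf => [|n IH] f mf.
  rewrite (_ : (fun _ => _) = (fun=> 0)); first exact: cmeasurable_cst.
  by apply/funext => x; rewrite big_ord0.
rewrite (_ : (fun _ => _) =
    (fun x => f ord0 x + \sum_i f (lift ord0 i) x)); last first.
  by apply/funext => x; rewrite big_ord_recl.
by apply: cmeasurableD => //; exact: IH.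
Qed.

Lemma measurable_normc_sqr f : cmeasurable_fun D f ->
  measurable_fun D (fun x => (Normc.normc (f x) ^+ 2)%:E).
Proof.
move=> [f1 f2]; apply/measurable_EFinP.
rewrite (_ : (fun _ => _) =
    (fun x => complex.Re (f x) ^+ 2 + complex.Im (f x) ^+ 2)).
  by apply: measurable_funD; exact: measurable_funX.
by apply/funext => x; rewrite normc_sqr.
Qed.

End cmeasurable.

Lemma cmeasurable_comp (d1 d2 : measure_display) (T1 : measurableType d1)
    (T2 : measurableType d2) (R : realType) (D : set T1) (E : set T2)
    (g : T1 -> T2) (f : T2 -> R[i]) :
  measurable E -> g @` D `<=` E -> measurable_fun D g ->
  cmeasurable_fun E f -> cmeasurable_fun D (fun x => f (g x)).
Proof.
by move=> mE gDE mg [f1 f2]; split; [move: f1|move: f2] => mf;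
  exact: (measurable_comp mE gDE mf mg).
Qed.

(** * Centred random variables *)

Section centred.
Context (dO : measure_display) (Omega : measurableType dO) (R : realType).
Variable P : probability Omega R.

(** This is [has_cexpectation P _ 0] for real random variables, phrased with the
    integral itself rather than with its [fine] part, so that additivity of the
    integral applies. *)
Definition centred (g : Omega -> R) : Prop :=
  P.-integrable setT (EFin \o g) /\ (\int[P]_w (g w)%:E = 0)%E.

Lemma centredD g h : centred g -> centred h -> centred (fun w => g w + h w).
Proof.
move=> [ig g0] [ih h0]; split.
  rewrite (_ : _ \o _ = ((EFin \o g) \+ (EFin \o h))%E) //.
  exact: integrableD.
under eq_integral do rewrite EFinD.
by rewrite (integralD_EFin measurableT ig ih) /= g0 h0 adde0.
Qed.

Lemma centredZ k g : centred g -> centred (fun w => k * g w).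
Proof.
move=> [ig g0]; split.
  rewrite (_ : _ \o _ = (fun w => k%:E * (EFin \o g) w)%E) //.
  exact: integrableZl.
under eq_integral do rewrite EFinM.
by rewrite (integralZl measurableT ig) g0 mule0.
Qed.

Lemma has_cexpectation0P (Z : Omega -> R[i]) : has_cexpectation P Z 0 <->
  centred (fun w => complex.Re (Z w)) /\ centred (fun w => complex.Im (Z w)).
Proof.
split.
  move=> [[iR iI]]; rewrite /cexpectation unlock => -[eR eI].
  by split; split => //; rewrite -[LHS]fineK ?integrable_fin_num// ?eR ?eI.
move=> [[iR eR] [iI eI]]; split; first by split.
by rewrite /cexpectation unlock eR eI.
Qed.

Lemma has_cexpectation0_cst0 : has_cexpectation P (fun=> 0) 0.
Proof.
by apply/has_cexpectation0P; split; split;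
  [exact: integrable0|exact: integral0|exact: integrable0|exact: integral0].
Qed.

Lemma has_cexpectation0D Y Z : has_cexpectation P Y 0 ->
  has_cexpectation P Z 0 -> has_cexpectation P (fun w => Y w + Z w) 0.
Proof.
move=> /has_cexpectation0P[Y1 Y2] /has_cexpectation0P[Z1 Z2].
apply/has_cexpectation0P; split.
- rewrite (_ : (fun _ => _) =
    (fun w => complex.Re (Y w) + complex.Re (Z w))); first exact: centredD.
  by apply/funext => w; case: (Y w) => ? ?; case: (Z w).
- rewrite (_ : (fun _ => _) =
    (fun w => complex.Im (Y w) + complex.Im (Z w))); first exact: centredD.
  by apply/funext => w; case: (Y w) => ? ?; case: (Z w).
Qed.

Lemma has_cexpectation0Z (a : R[i]) Z : has_cexpectation P Z 0 ->
  has_cexpectation P (fun w => a * Z w) 0.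
Proof.
move=> /has_cexpectation0P[Z1 Z2].
apply/has_cexpectation0P; split.
- rewrite (_ : (fun _ => _) = (fun w => complex.Re a * complex.Re (Z w) +
    (- complex.Im a) * complex.Im (Z w))).
    by apply: centredD; exact: centredZ.
  by apply/funext => w; case: a => ? ?; case: (Z w) => ? ? /=; rewrite mulNr.
- rewrite (_ : (fun _ => _) = (fun w => complex.Re a * complex.Im (Z w) +
    complex.Im a * complex.Re (Z w))).
    by apply: centredD; exact: centredZ.
  by apply/funext => w; case: a => ? ?; case: (Z w).
Qed.

Lemma has_cexpectation0_sum (n : nat) (p : pred 'I_n)
    (Z : 'I_n -> Omega -> R[i]) :
  (forall i, p i -> has_cexpectation P (Z i) 0) ->
  has_cexpectation P (fun w => \sum_(i | p i) Z i w) 0.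
Proof.
move=> Z0.
(* The sum is taken in the space of functions, with pointwise addition. *)
rewrite (_ : (fun _ => _) =
    (\big[(fun Y Y' w => Y w + Y' w)/(fun=> 0)]_(i | p i) Z i)).
  apply: (big_ind (fun Y => has_cexpectation P Y 0)) => //.
  - exact: has_cexpectation0_cst0.
  - exact: has_cexpectation0D.
apply/funext => w.
by elim/big_ind2 : _ => // ? ? ? ? -> ->.
Qed.

Lemma has_cexpectation_measurable (Z : Omega -> R[i]) m :
  has_cexpectation P Z m -> cmeasurable_fun setT Z.
Proof.
by move=> [[/measurable_int/measurable_EFinP ?
  /measurable_int/measurable_EFinP ?] _].
Qed.

(** The function [f] may have infinite integral, so additivity of the integral
    does not apply directly. Moving the negative part [g^\-] to the left,
    [(f + g) + g^\- = f + g^\+] is an identity between nonnegative functions,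
    and [g^\+], [g^\-] have the same finite integral. *)
Lemma ge0_integral_add_centred (f g : Omega -> R) :
  measurable_fun setT f -> (forall w, 0 <= f w) ->
  (forall w, 0 <= f w + g w) -> centred g ->
  (\int[P]_w (f w + g w)%:E = \int[P]_w (f w)%:E)%E.
Proof.
move=> mf f0 fg0 [ig g0]; have mg := measurable_int _ ig.
have gfin := integrable_neg_fin_num measurableT ig.
have gE : (\int[P]_w (EFin \o g)^\+ w = \int[P]_w (EFin \o g)^\- w)%E.
  have : (\int[P]_w (EFin \o g) w = 0)%E by [].
  by rewrite integralE => /eqP; rewrite sube_eq ?add0e ?gfin//
    ?integrable_pos_fin_num// => /eqP.
have mfg : measurable_fun setT (fun w => (f w + g w)%:E).
  apply/measurable_EFinP; apply: measurable_funD => //.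
  exact/measurable_EFinP.
have : (\int[P]_w ((f w + g w)%:E + (EFin \o g)^\- w) =
        \int[P]_w ((f w)%:E + (EFin \o g)^\+ w))%E.
  apply: eq_integral => w _.
  rewrite funenegE funeposE /= -!EFin_max -!EFinD; congr _%:E.
  have [?|/ltW ?] := leP 0 (g w); first by rewrite max_r ?oppr_le0// addr0.
  by rewrite max_l ?oppr_ge0// addrK addr0.
rewrite !ge0_integralD//.
- rewrite gE => /(congr1 (fun z => z - \int[P]_w (EFin \o g)^\- w)%E).
  by rewrite !addeK.
- by move=> w _; rewrite lee_fin.
- exact/measurable_EFinP.
- exact: measurable_funepos.
- by move=> w _; rewrite lee_fin.
- exact: measurable_funeneg.
Qed.

(** Expanding the square leaves, besides the diagonal, the real part of a
    combination of the [Z i] and of the products [(Z i)^* * Z j] with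
    [i != j], which is centred. Both sides may be infinite. *)
Lemma second_moment_uncorrelated (n : nat) (h : R[i])
    (Z : 'I_n -> Omega -> R[i]) :
  (forall i, has_cexpectation P (Z i) 0) ->
  (forall i j, i != j -> has_cexpectation P (fun w => (Z i w)^* * Z j w) 0) ->
  (\int[P]_w (Normc.normc (h + \sum_i Z i w)%R ^+ 2)%:E =
   (Normc.normc h ^+ 2)%:E + \sum_i \int[P]_w (Normc.normc (Z i w) ^+ 2)%:E)%E.
Proof.
move=> Z0 ZZ0.
(* [complex.Re (W w)] collects all cross terms of the expanded square. *)
pose W w := 2 * h^* * (\sum_i Z i w) +
  \sum_i \sum_(j | j != i) (Z i w)^* * Z j w.
have W0 : has_cexpectation P W 0.
  apply: has_cexpectation0D.
    by apply: has_cexpectation0Z; exact: has_cexpectation0_sum.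
  apply: has_cexpectation0_sum => i _; apply: has_cexpectation0_sum => j ji.
  by apply: ZZ0; rewrite eq_sym.
have /has_cexpectation0P[ReW0 _] := W0.
pose D w := Normc.normc h ^+ 2 + \sum_i Normc.normc (Z i w) ^+ 2.
have mZ i : measurable_fun setT (fun w => (Normc.normc (Z i w) ^+ 2)%:E).
  by apply: measurable_normc_sqr => //; exact: has_cexpectation_measurable.
have DW w : Normc.normc (h + \sum_i Z i w) ^+ 2 = D w + complex.Re (W w).
  rewrite normc_sqrD normc_sqr_sum /D /W -!addrA; congr (_ + (_ + _)).
  by case: (2 * _ * _) => ? ?; case: (\sum_i _) => ? ?; rewrite /= addrC.
under eq_integral do rewrite DW.
rewrite ge0_integral_add_centred//.
- rewrite /D; under eq_integral do rewrite EFinD -sumEFin.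
  rewrite ge0_integralD//.
  + rewrite integral_cst//= probability_setT mule1 ge0_integral_sum//.
    by move=> i w _; rewrite lee_fin normc_sqr_ge0.
  + by move=> w _; rewrite lee_fin normc_sqr_ge0.
  + by move=> w _; apply: sume_ge0 => i _; rewrite lee_fin normc_sqr_ge0.
  + exact: emeasurable_sum.
- apply: measurable_funD => //; apply: measurable_sum => i.
  by apply/measurable_EFinP; exact: mZ.
- by move=> w; rewrite addr_ge0 ?normc_sqr_ge0// sumr_ge0// => i _;
    rewrite normc_sqr_ge0.
- by move=> w; rewrite -DW normc_sqr_ge0.
Qed.

End centred.

(** * Integrals over a measurable subset *)

Section subset_integrals.
Context (dT : measure_display) (T : measurableType dT) (R : realType).
Variables (X : set T) (mX : measurable X) (rho : probability T R).

(** The squaring undoes the outer root of the norm; when the integral is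
    infinite both sides are [+oo]. *)
Lemma L2norm_sqr (g : T -> R[i]) :
  (L2norm X rho g ^+ 2 = \int[rho]_(x in X) (Normc.normc (g x) ^+ 2)%:E)%E.
Proof.
have sqE (y : \bar R) : (0 <= y)%E -> (y ^+ 2 = y `^ 2%R)%E.
  case: y => [r r0|_|//]; last by rewrite expe2 mulyy /= pnatr_eq0.
  by rewrite poweR_EFin powR_mulrn.
rewrite /L2norm sqE ?Lnorm_ge0// poweR_Lnorm ?pnatr_eq0// [RHS]integral_mkcond.
apply: eq_integral => x _; rewrite !patchE; case: ifP => _.
  by rewrite /= ger0_norm ?normc_nneg// powR_mulrn ?normc_nneg.
by rewrite abse0 poweR0r// pnatr_eq0.
Qed.

Context (dO : measure_display) (Omega : measurableType dO).
Variables (P : probability Omega R) (F : Omega * T -> \bar R).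
Hypothesis mF : measurable_fun ([set: Omega] `*` X) F.
Hypothesis F_ge0 : forall p, (0 <= F p)%E.

(* Extension by zero turns integrals over [X] into integrals over [T], where
   Tonelli's theorem for product measures is available. *)
Let G := F \_ ([set: Omega] `*` X).

Let mG : measurable_fun setT G.
Proof. exact: (measurable_restrictT F (measurableX measurableT mX)).1 mF. Qed.

Let G_ge0 p : (0 <= G p)%E.
Proof. by rewrite /G patchE; case: ifP. Qed.

Let GE w x : G (w, x) = ((fun y => F (w, y)) \_ X) x.
Proof. by rewrite /G !patchE !in_setX in_setT. Qed.

Let integralG x : x \in X -> (\int[P]_w G (w, x) = \int[P]_w F (w, x))%E.
Proof. by move=> xX; apply: eq_integral => w _; rewrite GE patchE xX. Qed.

Lemma measurable_section_integral :
  measurable_fun X (fun x => \int[P]_w F (w, x))%E.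
Proof.
apply: (eq_measurable_fun (fubini_G P G)) => [x xX|].
  by rewrite /fubini_G integralG.
apply: measurable_funTS.
by have := measurable_fun_fubini_tonelli_G (m1 := P) G mG G_ge0.
Qed.

Lemma tonelli_subset :
  (\int[P]_w \int[rho]_(x in X) F (w, x) =
   \int[rho]_(x in X) \int[P]_w F (w, x))%E.
Proof.
transitivity (\int[P]_w \int[rho]_x G (w, x))%E.
  apply: eq_integral => w _; rewrite integral_mkcond.
  by apply: eq_integral => x _; rewrite GE.
rewrite (fubini_tonelli G)// [RHS]integral_mkcond.
apply: eq_integral => x _; rewrite patchE; case: ifPn => [/integralG//|xX].
by apply: integral0_eq => w _; rewrite GE patchE (negbTE xX).
Qed.

End subset_integrals.

(** * Lower bound for randomly perturbed synthesis *)

Lemma cnorm2_sqr (R : rcfType) (n : nat) (c : 'cV[R[i]]_n) :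
  cnorm2 c ^+ 2 = \sum_i Normc.normc (c i 0) ^+ 2.
Proof. by rewrite sqr_sqrtr// sumr_ge0// => i _; exact: normc_sqr_ge0. Qed.

Section perturbed_synthesis.
Context (dT : measure_display) (T : measurableType dT) (R : realType).
Variables (X : set T) (mX : measurable X) (rho : probability T R).
Context (dO : measure_display) (Omega : measurableType dO).
Variable P : probability Omega R.
Variables (n : nat) (phi : 'I_n -> T -> R[i]) (f : T -> R[i]).
Hypothesis mphi : forall i, cmeasurable_fun X (phi i).
Hypothesis mf : cmeasurable_fun X f.
Variable delta : 'I_n -> Omega -> T -> R[i].
Hypothesis mdelta : forall i, random_function X (delta i).
Hypothesis delta_mean : forall x, X x -> forall i,
  has_cexpectation P (fun w => delta i w x) 0.
Hypothesis delta_uncorr : forall x, X x -> forall i j, i != j ->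
  has_cexpectation P (fun w => (delta i w x)^* * delta j w x) 0.

Let mOX : measurable ([set: Omega] `*` X).
Proof. exact: measurableX. Qed.

Let noise i (p : Omega * T) :=
  (Normc.normc (phi i p.2 * delta i p.1 p.2) ^+ 2)%:E.

Let cmeasurable_snd (g : T -> R[i]) : cmeasurable_fun X g ->
  cmeasurable_fun ([set: Omega] `*` X) (fun p => g p.2).
Proof.
apply: cmeasurable_comp => //; first by move=> _ [p [_ Xp] <-].
exact: measurable_funTS.
Qed.

Let measurable_noise i : measurable_fun ([set: Omega] `*` X) (noise i).
Proof.
apply: measurable_normc_sqr => //; apply: cmeasurableM; last exact: mdelta.
exact: cmeasurable_snd.
Qed.

Let noise_ge0 i p : (0 <= noise i p)%E.
Proof. by rewrite lee_fin normc_sqr_ge0. Qed.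

Lemma perturb_sub i w x :
  perturb phi delta w i x - phi i x = phi i x * delta i w x.
Proof. by rewrite /perturb mulrDr mulr1 addrAC subrr add0r. Qed.

Lemma expected_perturbation i :
  (\int[P]_w (L2norm X rho
     (fun x => perturb phi delta w i x - phi i x)%R) ^+ 2 =
   \int[rho]_(x in X) \int[P]_w noise i (w, x))%E.
Proof.
rewrite -tonelli_subset//; apply: eq_integral => w _.
by rewrite L2norm_sqr; apply: eq_integral => x _; rewrite perturb_sub.
Qed.

Lemma synthesis_perturb_sub (c : 'cV[R[i]]_n) w x :
  synthesis (perturb phi delta w) c x - f x =
  (synthesis phi c x - f x) + \sum_i c i 0 * (phi i x * delta i w x).
Proof.
rewrite addrAC; congr (_ - _); rewrite /synthesis -big_split /=.
by apply: eq_bigr => i _; rewrite /perturb -mulrDr [in LHS]mulrDr mulr1.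
Qed.

(** This is the bias-variance decomposition: at each [x] the variables
    [c i * phi i x * delta i w x] are centred and uncorrelated, so their second
    moments add; integrating over [X] and exchanging the integrals turns each
    summand into the size of one perturbation. *)
Lemma expected_synthesis_error (c : 'cV[R[i]]_n) :
  (\int[P]_w (L2norm X rho
     (fun x => synthesis (perturb phi delta w) c x - f x)%R) ^+ 2 =
   (L2norm X rho (fun x => synthesis phi c x - f x)%R) ^+ 2 +
   \sum_i (Normc.normc (c i 0) ^+ 2)%:E *
     \int[P]_w (L2norm X rho
       (fun x => perturb phi delta w i x - phi i x)%R) ^+ 2)%E.
Proof.
pose h x := synthesis phi c x - f x.
have mh : cmeasurable_fun X h.
  apply: cmeasurableD => //.
    apply: cmeasurable_sum => // i.
    by apply: cmeasurableM; [exact: cmeasurable_cst|exact: mphi].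
  rewrite (_ : (fun _ => _) = (fun x => (-1) * f x)).
    by apply: cmeasurableM; [exact: cmeasurable_cst|exact: mf].
  by apply/funext => x; rewrite mulN1r.
pose F (p : Omega * T) := (Normc.normc
  (h p.2 + \sum_i c i 0 * (phi i p.2 * delta i p.1 p.2)) ^+ 2)%:E.
have mF : measurable_fun ([set: Omega] `*` X) F.
  apply: measurable_normc_sqr => //; apply: cmeasurableD => //.
    exact: cmeasurable_snd.
  apply: cmeasurable_sum => // i; apply: cmeasurableM => //.
  by apply: cmeasurableM; [exact: cmeasurable_snd|exact: mdelta].
have F_ge0 p : (0 <= F p)%E by rewrite lee_fin normc_sqr_ge0.
transitivity (\int[P]_w \int[rho]_(x in X) F (w, x))%E.
  apply: eq_integral => w _; rewrite L2norm_sqr.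
  by apply: eq_integral => x _; rewrite synthesis_perturb_sub.
rewrite tonelli_subset// L2norm_sqr.
have Q_ge0 i x : (0 <= \int[P]_w noise i (w, x))%E by exact: integral_ge0.
have mQ i : measurable_fun X (fun x => \int[P]_w noise i (w, x))%E.
  exact: measurable_section_integral.
have FE x : x \in X -> (\int[P]_w F (w, x) = (Normc.normc (h x) ^+ 2)%:E +
    \sum_i (Normc.normc (c i 0) ^+ 2)%:E * \int[P]_w noise i (w, x))%E.
  move=> /set_mem Xx.
  rewrite (@second_moment_uncorrelated _ _ _ P _ (h x)
    (fun i w => c i 0 * (phi i x * delta i w x))).
  - congr (_ + _)%E; apply: eq_bigr => i _.
    rewrite -ge0_integralZl_EFin//.
    + by apply: eq_integral => w _; rewrite Normc.normcM exprMn EFinM.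
    + have := has_cexpectation0Z (phi i x) (delta_mean Xx i).
      by move=> /has_cexpectation_measurable; exact: measurable_normc_sqr.
    + exact: normc_sqr_ge0.
  - by move=> i; do 2 apply: has_cexpectation0Z; exact: delta_mean.
  - move=> i j ij.
    have := has_cexpectation0Z ((c i 0 * phi i x)^* * (c j 0 * phi j x))
      (delta_uncorr Xx ij).
    congr has_cexpectation; apply/funext => w.
    by rewrite !rmorphM /=; ring.
rewrite (eq_integral _ _ FE) ge0_integralD//.
- congr (_ + _)%E; rewrite ge0_integral_sum//.
  + apply: eq_bigr => i _; rewrite ge0_integralZl_EFin ?normc_sqr_ge0//.
    by rewrite expected_perturbation.
  + by move=> i; exact: measurable_funeM.
  + by move=> i x _; rewrite mule_ge0// lee_fin normc_sqr_ge0.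
- by move=> x _; rewrite lee_fin normc_sqr_ge0.
- exact: measurable_normc_sqr.
- by move=> x _; apply: sume_ge0 => i _;
    rewrite mule_ge0// lee_fin normc_sqr_ge0.
- by apply: emeasurable_sum => i; exact: measurable_funeM.
Qed.

End perturbed_synthesis.

Theorem theorem8 (R : realType) (d : nat)
  (X : set (d.-tuple (measurableTypeR R))) (mX : measurable X)
  (rho : probability (d.-tuple (measurableTypeR R)) R)
  (rhoX : rho X = 1%E) (rho_nonatomic : nonatomic rho)
  (n : nat) (phi : 'I_n -> d.-tuple (measurableTypeR R) -> R[i])
  (phiL2 : forall i, in_L2 X rho (phi i))
  (dO : measure_display) (Omega : measurableType dO)
  (P : probability Omega R)
  (delta : 'I_n -> Omega -> d.-tuple (measurableTypeR R) -> R[i])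
  (delta_rf : forall i, random_function X (delta i))
  (deltaL2 : forall i, in_L2_Linfty P X rho (delta i))
  (delta_mean : forall x, X x -> forall i,
    has_cexpectation P (fun w => delta i w x) 0)
  (delta_uncorr : forall x, X x -> forall i j, i != j ->
    has_cexpectation P (fun w => (delta i w x)^* * delta j w x) 0)
  (u : R) (u_gt0 : 0 < u) (C : R) (C_gt0 : 0 < C)
  (lower : forall i,
    ((C * u ^+ 2)%:E <=
     \int[P]_w (L2norm X rho
       (fun x => perturb phi delta w i x - phi i x)%R) ^+ 2)%E)
  (c : 'cV[R[i]]_n)
  (f : d.-tuple (measurableTypeR R) -> R[i]) (fL2 : in_L2 X rho f) :
  ((L2norm X rho (fun x => synthesis phi c x - f x)%R) ^+ 2
     + (C * u ^+ 2 * cnorm2 c ^+ 2)%:E <=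
   \int[P]_w (L2norm X rho
     (fun x => synthesis (perturb phi delta w) c x - f x)%R) ^+ 2)%E.
Proof.
rewrite (expected_synthesis_error mX rho (fun i => proj1 (phiL2 i)) (proj1 fL2)
  delta_rf delta_mean delta_uncorr c).
apply: leeD => //; rewrite cnorm2_sqr mulr_sumr -sumEFin.
apply: lee_sum => i _; rewrite mulrC EFinM lee_pmul//.
- by rewrite lee_fin normc_sqr_ge0.
- by rewrite lee_fin mulr_ge0 ?sqr_ge0// ltW.
Qed.
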